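(* Let $p$ be a prime, and let $H \in \mathbb{N}$ and $m_1, \ldots, m_H \in \mathbb{Z}$. For all sufficiently large $N \in \mathbb{N}$ (i.e., there is $N_0$ depending on $p, H, m_1, \ldots, m_H$ such that for every $N \geq N_0$), there exist sets $A,B \subseteq (\mathbb{Z}/p\mathbb{Z})^N$ such that $$|hA|-|hB|=m_h$$ for each $1 \leq h \leq H$.
   Context: $\mathbb{N}$ denotes the positive integers. For a subset $A$ of an abelian group and $h \in \mathbb{N}$, the $h$-fold iterated sumset is $hA:=\{a_1+\cdots+a_h : a_1,\ldots,a_h \in A\}$ (repetitions allowed). $|X|$ denotes the cardinality of a finite set $X$. *)

(* Defs.v *)
From HB Require Import structures.
From mathcomp Require Import all_boot all_order all_algebra.

Set Implicit Arguments.
Unset Strict Implicit.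
Unset Printing Implicit Defensive.

Import GRing.Theory.
Local Open Scope ring_scope.

Definition sumset (V : finZmodType) (h : nat) (A : {set V}) : {set V} :=
  [set \sum_(i < h) a i | a : {ffun 'I_h -> V} in ffun_on (mem A)].

(* Main.v *)
(* Grade the group by W = F_p^(1 + H), with basis y, e_1, ..., e_H and weight
   the sum of the residues, and put over it fibres in V = Q^H * S.  The set has
   the whole of V over 0, the complement of a set M over y, and the punctured
   i-th axis Q \ {0} over e_i.  Its h-fold sumset contains all of V over every w
   of weight < h, so only the layer of weight h depends on M, and there only the
   fibres over y + v with v in the span of the e_i: the fibre over y + v misses
   the u such that u minus the box X_v is contained in M.  Let M be the union,
   over the s in S that carry a label j, of a copy in Q^H * {s} of the orthant
   M_j = (Q \ {0})^j * {0}.  If r_j elements carry the label j, the layer of weight h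
   loses sum_j r_j c(h, j) points, where c(h, j) counts the translates
   of boxes of weight h - 1 inside M_j.  The largest box inside M_j is M_j itself,
   of weight j, and it fits in only one way, so c(j + 1, j) = 1 and c(h, j) = 0 for
   h > j + 1.  The integer system sum_j d_j c(h, j) = m_h is therefore unitriangular,
   and the r_j of the two sets are taken to be the negative and positive parts of
   the d_j. *)
Require Import Defs.
From HB Require Import structures.
From mathcomp Require Import all_boot all_order all_algebra.

Set Implicit Arguments.
Unset Strict Implicit.
Unset Printing Implicit Defensive.

Import GRing.Theory VectorInternalTheory.
Local Open Scope ring_scope.

(** * Iterated sumsets and additive maps *)

HB.instance Definition _ (V W : finZmodType) := GRing.Zmodule.on (V * W)%type.
HB.instance Definition _ (I : finType) (V : finZmodType) :=
  GRing.Zmodule.on {ffun I -> V}.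

(** Coordinates padded with zeros, so that one fixed construction serves every large [N]. *)
Lemma vectType_embedding (K : fieldType) (vT : vectType K) (N : nat) :
  (dim vT <= N)%N -> exists f : {additive vT -> 'rV[K]_N}, injective f.
Proof.
move=> /subnKC <-.
pose f (x : vT) : 'rV[K]_(dim vT + (N - dim vT)) := row_mx (v2r x) 0.
have fB : zmod_morphism f.
  by move=> x y; rewrite /f linearB opp_row_mx add_row_mx oppr0 addr0.
pose fA : {additive vT -> _} := HB.pack f (GRing.isZmodMorphism.Build _ _ f fB).
by exists fA => x y /eq_row_mx[/v2r_inj].
Qed.

Lemma sumset0 (V : finZmodType) (A : {set V}) : sumset 0 A = [set 0].
Proof.
apply/setP=> x; rewrite inE; apply/imsetP/eqP => [[a _ ->]|->].
  by rewrite big_ord0.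
exists [ffun=> 0]; last by rewrite big_ord0.
by apply/ffun_onP; case.
Qed.

Lemma sumsetS (V : finZmodType) (h : nat) (A : {set V}) :
  sumset h.+1 A = [set a + b | a in A, b in sumset h A].
Proof.
apply/setP=> x; apply/imsetP/imset2P => [[a /ffun_onP aA ->]|].
  rewrite big_ord_recl; exists (a ord0) (\sum_(i < h) a (lift ord0 i)) => //.
  apply/imsetP; exists [ffun i => a (lift ord0 i)].
    by apply/ffun_onP=> i; rewrite ffunE.
  by apply: eq_bigr => i _; rewrite ffunE.
case=> a b aA /imsetP[c /ffun_onP cA ->] ->.
exists [ffun i => oapp c a (unlift ord0 i)].
  by apply/ffun_onP=> i; rewrite ffunE; case: unliftP => [j _|_]; [apply: cA|].
rewrite big_ord_recl ffunE unlift_none; congr (_ + _).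
by apply: eq_bigr => i _; rewrite ffunE liftK.
Qed.

Lemma sumset_imset (V W : finZmodType) (f : {additive V -> W}) h (A : {set V}) :
  sumset h (f @: A) = f @: sumset h A.
Proof.
elim: h => [|h IHh]; first by rewrite !sumset0 imset_set1 raddf0.
rewrite !sumsetS IHh; apply/setP=> x; apply/imset2P/imsetP.
  case=> _ _ /imsetP[a aA ->] /imsetP[b bA ->] ->.
  by exists (a + b); rewrite ?raddfD //; apply: imset2_f.
case=> _ /imset2P[a b aA bA ->] ->.
by exists (f a) (f b); rewrite ?raddfD ?imset_f.
Qed.

(** * Residues modulo [p], unit vectors and weight *)

Lemma ltn_Fp (p : nat) (x : 'F_p) : prime p -> (x < p)%N.
Proof. by move/Fp_cast=> {2}<-; apply: ltn_ord. Qed.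

Lemma val_FpS (p : nat) (x : 'F_p) : prime p ->
  (x + 1 : 'F_p) = (if x.+1 == p then 0 else x.+1) :> nat.
Proof.
move=> p_prime; have p_gt1 := prime_gt1 p_prime.
have xlt := ltn_Fp x p_prime.
rewrite /= [X in (1 %% X)%N](Fp_cast p_prime) (modn_small p_gt1) addn1.
rewrite [X in (_ %% X)%N](Fp_cast p_prime).
by have [->|ne] := eqVneq; rewrite ?modnn // modn_small // ltn_neqAle ne.
Qed.

Definition weight (p : nat) (I : finType) (w : {ffun I -> 'F_p}) : nat :=
  (\sum_i (w i : nat))%N.

Definition unit_vec (p : nat) (I : finType) (i : I) : {ffun I -> 'F_p} :=
  [ffun k => (k == i)%:R].

Lemma unit_vecE p (I : finType) (w : {ffun I -> 'F_p}) i k :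
  (w + unit_vec p i) k = if k == i then w i + 1 else w k.
Proof.
by rewrite !ffunE; case: eqP => [->|_]; rewrite ?addr0.
Qed.

Lemma val_unit_vec p (I : finType) (w : {ffun I -> 'F_p}) i k : prime p ->
  ((w i).+1 < p)%N ->
  (w + unit_vec p i) k = (if k == i then (w i).+1 else w k) :> nat.
Proof.
move=> p_prime wi; rewrite unit_vecE; case: eqP => // _.
by rewrite val_FpS // ltn_eqF.
Qed.

Lemma weight_unit_vec p (I : finType) (w : {ffun I -> 'F_p}) i : prime p ->
  ((w i).+1 < p)%N -> weight (w + unit_vec p i) = (weight w).+1.
Proof.
move=> p_prime wi; rewrite /weight (bigD1 i) //= [in RHS](bigD1 i) //=.
rewrite val_unit_vec // eqxx addSn; congr (_ + _).+1.
by apply: eq_bigr => k /negPf ki; rewrite val_unit_vec // ki.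
Qed.

(** The residue [p - 1] wraps to 0; in a sumset such a sum falls in a layer that is already full. *)
Lemma weight_unit_vec_wrap p (I : finType) (w : {ffun I -> 'F_p}) i : prime p ->
  ~~ ((w i).+1 < p)%N -> (weight (w + unit_vec p i)%R <= weight w)%N.
Proof.
move=> p_prime wi; apply: leq_sum => k _; rewrite unit_vecE; case: eqP => // ->.
have wlt := ltn_Fp (w i) p_prime.
have wip : (w i).+1 == p by rewrite eqn_leq wlt leqNgt.
by rewrite val_FpS // wip.
Qed.

Lemma weight_eq0 p (I : finType) (w : {ffun I -> 'F_p}) :
  (weight w == 0)%N = (w == 0).
Proof.
rewrite /weight sum_nat_eq0; apply/forallP/eqP => [w0|-> i]; last by rewrite ffunE.
by apply/ffunP => i; apply/val_inj; rewrite ffunE; apply/eqP; apply: w0.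
Qed.

Lemma unit_vec_pred p (I : finType) (w : {ffun I -> 'F_p}) : prime p ->
  w != 0 -> exists i, (((w - unit_vec p i)%R i).+1 < p)%N.
Proof.
move=> p_prime w0; have [i wi] : exists i, w i != 0.
  apply/existsP; apply: contraNT w0 => /existsPn w0; apply/eqP/ffunP => i.
  by rewrite ffunE; apply/eqP; rewrite -[_ == _]negbK.
have wlt := ltn_Fp (w i) p_prime.
have := val_FpS ((w - unit_vec p i) i) p_prime.
rewrite !ffunE eqxx subrK; case: eqP => [_ w0'|_ wE].
  by case/eqP: wi; apply: val_inj.
by exists i; rewrite !ffunE eqxx -wE.
Qed.

(** * Iterated sumsets of a graded set *)

Section Graded.
Variables (p : nat) (p_prime : prime p) (I : finType) (V : finZmodType).
Local Notation W := {ffun I -> 'F_p}.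
Variables (C : I -> {set V}) (F : W -> {set V}).

(* [V] sits over [0], so that over every [w] of weight less than [h] the whole of
   [V] lies in the [h]-fold sumset: only the weight-[h] layer sees the [C i]. *)
Definition graded_set : {set W * V} :=
  [set x | (x.1 == 0) || [exists i, (x.1 == unit_vec p i) && (x.2 \in C i)]].

Hypothesis F0 : F 0 = [set 0].
Hypothesis F_neq0 : forall w, F w != set0.
Hypothesis FS : forall (w : W) i, ((w i).+1 < p)%N ->
  F (w + unit_vec p i) = [set a + b | a in F w, b in C i].

(** Induction on [h]: steps without wrapping raise the weight by one and act on fibres by [FS],
    while the full fibre over 0 fills every lower layer. *)
Lemma sumset_graded h w v : ((w, v) \in sumset h graded_set) =
  (weight w < h)%N || (weight w == h) && (v \in F w).
Proof.
elim: h => [|h IHh] in w v *.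
  rewrite sumset0 inE xpair_eqE weight_eq0 /=; case: eqP => //= ->.
  by rewrite F0 inE.
rewrite sumsetS; apply/imset2P/idP.
  case=> [[wa va] [wb vb]]; rewrite IHh inE /=.
  case/orP=> [/eqP->|/existsP[i /andP[/eqP-> vaC]]] bT [-> ->].
    by rewrite add0r ltnS; case/orP: bT => [/ltnW->|/andP[/eqP->]]; rewrite ?leqnn.
  rewrite addrC; have [wbi|wbi] := boolP ((wb i).+1 < p)%N; last first.
    rewrite ltnS (leq_trans (weight_unit_vec_wrap p_prime wbi)) //.
    by case/orP: bT => [/ltnW->|/andP[/eqP->]].
  rewrite weight_unit_vec // ltnS eqSS FS //; case/orP: bT => [->//|/andP[-> vbF]].
  by apply/orP; right; rewrite [va + vb]addrC; apply: imset2_f.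
rewrite ltnS leq_eqVlt -orbA => /or3P[/eqP wE|wE|/andP[/eqP wE vF]].
(* The former top layer becomes full: [v - f], taken over 0, corrects any [f] of the fibre. *)
- have /set0Pn[f fF] := F_neq0 w.
  exists (0, v - f) (w, f); rewrite ?inE ?eqxx //.
    by rewrite IHh wE eqxx fF orbT.
  by congr pair; rewrite ?add0r ?subrK.
- exists (0, 0) (w, v); rewrite ?inE ?eqxx //; first by rewrite IHh wE.
  by congr pair; rewrite add0r.
have [|i wi] := unit_vec_pred p_prime (w := w).
  by rewrite -weight_eq0 wE.
move: wE vF; rewrite -[w](subrK (unit_vec p i)) weight_unit_vec // FS //.
move: wi; set w' := w - _ => wi [wE] /imset2P[f c fF cC ->].
exists (unit_vec p i, c) (w', f).
- by rewrite inE; apply/orP; right; apply/existsP; exists i; rewrite eqxx.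
- by rewrite IHh wE eqxx fF orbT.
by congr pair; rewrite addrC.
Qed.

End Graded.

(** * Fibres determined by the set [M], and the points missed *)

Section Fibres.
Variables (p : nat) (p_prime : prime p) (H : nat) (Q S : finZmodType).
Hypothesis Q_gt2 : (2 < #|Q|)%N.
Local Notation W := {ffun option 'I_H -> 'F_p}.
Local Notation U := {ffun 'I_H -> Q}.

Definition digit (n : nat) (x : Q) : bool :=
  match n with 0 => x == 0 | 1 => x != 0 | _ => true end.

(* The sumset of [w (Some i)] copies of the punctured i-th axis [Q \ {0}], over all
   [i]; since [2 < #|Q|], two copies already give the full axis. *)
Definition box (w : W) : {set U} :=
  [set q : U | [forall i, digit (w (Some i)) (q i)]].

Definition spike (i : 'I_H) (a : Q) : U := [ffun k => if k == i then a else 0].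

Lemma exists_neq2 (x y : Q) : exists2 a, a != x & a != y.
Proof.
have /subsetPn[a _] : ~~ ([set: Q] \subset [set x; y]).
  by apply: contraL Q_gt2 => /subset_leq_card; rewrite cardsT cards2 -leqNgt;
    case: (x != y) => // /leq_trans; apply.
by rewrite !inE negb_or => /andP[]; exists a.
Qed.

(** Recursion for iterated sumsets of [Q \ {0}]; two copies fill [Q] because some nonzero [a]
    differs from [x]. *)
Lemma digitS n x : digit n.+1 x = [exists a, (a != 0) && digit n (x - a)].
Proof.
apply/idP/existsP.
  case: n => [|[|n]] /= xn; first by exists x; rewrite subrr eqxx xn.
    have [a a0 ax] := exists_neq2 0 x.
    by exists a; rewrite a0 subr_eq0 eq_sym.
  by have [a a0 _] := exists_neq2 0 0; exists a; rewrite a0.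
by case: n => [|n] // [a /andP[a0 /=]]; rewrite subr_eq0 => /eqP->.
Qed.

Lemma box_neq0 w : box w != set0.
Proof.
have [a a0 _] := exists_neq2 0 0.
apply/set0Pn; exists [ffun i => if w (Some i) == 0%N :> nat then 0 else a].
by rewrite inE; apply/forallP=> i; rewrite ffunE; case: (nat_of_ord _) => [|[]] /=.
Qed.

Lemma box_unit_None w : box (w + unit_vec p None) = box w.
Proof.
by apply/setP=> q; rewrite !inE; apply: eq_forallb => i; rewrite unit_vecE.
Qed.

Lemma box_unit_Some (w : W) i q : ((w (Some i)).+1 < p)%N ->
  reflect (exists2 a, a != 0 & q - spike i a \in box w)
          (q \in box (w + unit_vec p (Some i))).
Proof.
move=> wi; rewrite inE; apply: (iffP forallP) => [bq|[a a0]].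
  have := bq i; rewrite val_unit_vec // eqxx digitS => /existsP[a /andP[a0 ba]].
  exists a => //; rewrite inE; apply/forallP => k; have := bq k.
  rewrite val_unit_vec // !ffunE (inj_eq (@Some_inj _)).
  by case: eqP => [->|_] //; rewrite subr0.
rewrite inE => /forallP bq k; have := bq k.
rewrite val_unit_vec // !ffunE (inj_eq (@Some_inj _)).
case: eqP => [->|_]; last by rewrite subr0.
by move=> ba; rewrite digitS; apply/existsP; exists a; rewrite a0.
Qed.

Definition generators (M : {set U * S}) (g : option 'I_H) : {set U * S} :=
  if g is Some i then [set (spike i a, 0) | a in [set~ 0]] else ~: M.

(** [w None] counts the summands from the complement of [M]: none leaves the box, one adds that
    complement to it, and two give everything once [M] is sparse. *)
Definition fibre (M : {set U * S}) (w : W) : {set U * S} :=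
  match w None : nat with
  | 0 => [set v | (v.1 \in box w) && (v.2 == 0)]
  | 1 => [set v | [exists x in box w, (v.1 - x, v.2) \notin M]]
  | _ => setT
  end.

(** The complement of [M] is an additive basis of order 2. *)
Definition sparse (M : {set U * S}) :=
  forall t, exists a b, [/\ a \notin M, b \notin M & t = a + b].

Lemma fibre0 M : fibre M 0 = [set 0].
Proof.
apply/setP=> [[u s]]; rewrite /fibre ffunE /= !inE xpair_eqE /=; congr (_ && _).
apply/forallP/eqP => [u0|-> i]; last by rewrite !ffunE /=.
by apply/ffunP=> i; have := u0 i; rewrite !ffunE /= => /eqP.
Qed.

Lemma fibre_neq0 M w : sparse M -> fibre M w != set0.
Proof.
move=> Msp; have /set0Pn[x xw] := box_neq0 w.
have [[a b] [_ [aM _ _]]] := Msp 0; apply/set0Pn.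
rewrite /fibre; case: (nat_of_ord _) => [|[|n]].
- by exists (x, 0); rewrite inE xw eqxx.
- exists (x + a, b); rewrite inE; apply/existsP; exists x.
  by rewrite xw /= [x + a]addrC addrK.
by exists 0; rewrite inE.
Qed.

Lemma fibreS M (w : W) g : sparse M -> ((w g).+1 < p)%N ->
  fibre M (w + unit_vec p g) = [set a + b | a in fibre M w, b in generators M g].
Proof.
move=> Msp wg; apply/setP=> [[u s]]; apply/idP/imset2P.
  case: g wg => [i|] wg /=.
    rewrite {1}/fibre val_unit_vec //=.
    have [e0 e0n0 _] := exists_neq2 0 0.
    case wN: (nat_of_ord _) => [|[|n]]; rewrite inE /=.
    - case/andP=> /(box_unit_Some _ wg)[a a0 ua] /eqP->.
      exists (u - spike i a, 0) (spike i a, 0).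
      + by rewrite /fibre wN inE ua eqxx.
      + by apply/imsetP; exists a; rewrite ?inE.
      by congr pair; rewrite ?subrK ?addr0.
    - case/exists_inP=> x /(box_unit_Some _ wg)[a a0 xa] uM.
      exists (u - spike i a, s) (spike i a, 0).
      + rewrite /fibre wN inE; apply/exists_inP; exists (x - spike i a) => //.
        by rewrite /= opprB addrA subrK.
      + by apply/imsetP; exists a; rewrite ?inE.
      by congr pair; rewrite ?subrK ?addr0.
    exists (u - spike i e0, s) (spike i e0, 0) => //.
    + by rewrite /fibre wN inE.
    + by apply/imsetP; exists e0; rewrite ?inE.
    by congr pair; rewrite ?subrK ?addr0.
  rewrite {1}/fibre val_unit_vec //= box_unit_None.
  case wN: (nat_of_ord _) => [|[|n]]; rewrite inE /=.
  - case/exists_inP=> x xw uM; exists (x, 0) (u - x, s).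
    + by rewrite /fibre wN inE xw eqxx.
    + by rewrite inE.
    by congr pair; rewrite ?[x + _]addrC ?subrK ?add0r.
  (* Sparsity splits the target minus a box point into two points outside [M]. *)
  - have /set0Pn[x xw] := box_neq0 w.
    have [[a1 a2] [b [aM bM ab]]] := Msp ((u, s) - (x, 0)).
    exists ((x, 0) + (a1, a2)) b.
    + rewrite /fibre wN inE; apply/exists_inP; exists x => //=.
      by rewrite [x + a1]addrC addrK add0r.
    + by rewrite inE.
    by rewrite -addrA -ab [RHS]addrC subrK.
  have [a [_ [aM _ _]]] := Msp 0.
  exists ((u, s) - a) a; rewrite ?subrK // ?inE //.
  by rewrite /fibre wN inE.
case=> f c fF cC ->; case: g wg cC => [i|] wg /=.
  case/imsetP=> a; rewrite !inE => a0 ->; move: fF.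
  rewrite /fibre val_unit_vec //=.
  case: (nat_of_ord _) => [|[|n]] //;
    rewrite inE /= => fF; rewrite inE //=; move: fF.
    case/andP=> fw /eqP->; rewrite addr0 eqxx andbT.
    by apply/(box_unit_Some _ wg); exists a; rewrite // addrK.
  case/exists_inP=> x xw fM; apply/exists_inP; exists (x + spike i a).
    by apply/(box_unit_Some _ wg); exists a; rewrite // addrK.
  by rewrite addr0 opprD addrACA subrr addr0.
rewrite inE => cM; move: fF.
rewrite /fibre val_unit_vec //= box_unit_None.
case: (nat_of_ord _) => [|[|n]] //; rewrite inE /= => fF; rewrite inE //=; move: fF.
case/andP=> fw /eqP f0; apply/exists_inP; exists f.1 => //.
by rewrite f0 add0r [f.1 + _]addrC addrK -surjective_pairing.
Qed.

(* The points of the weight-[h] layer that are missed because of [M]. *)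
Definition deficit (M : {set U * S}) (h : nat) : {set W * (U * S)} :=
  [set x | [&& weight x.1 == h, x.1 None == 1%N :> nat
    & [forall y in box x.1, (x.2.1 - y, x.2.2) \in M]]].

(** The empty [M] is a common reference that cancels when two choices of [M] are compared, leaving
    only their deficits. *)
Lemma card_sumset_deficit M h : sparse M ->
  (#|sumset h (graded_set p (generators M))| + #|deficit M h|
   = #|sumset h (graded_set p (generators set0))|)%N.
Proof.
move=> Msp; have sp0 : sparse set0.
  by move=> t; exists 0, t; rewrite !inE add0r.
have memE M' (M'sp : sparse M') := sumset_graded p_prime (fibre0 M')
  (fun w => fibre_neq0 w M'sp) (fun w g => @fibreS M' w g M'sp) h.
rewrite -(cardsID (deficit M h) (sumset h (graded_set p (generators set0)))) addnC.
have defE w v : ((w, v) \in deficit M h) = [&& weight w == h, w None == 1%N :> nat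
    & [forall y in box w, (v.1 - y, v.2) \in M]] by rewrite inE.
congr (_ + _)%N; apply: eq_card => -[w v].
  rewrite in_setI memE //; case wd: (_ \in deficit M h); rewrite ?andbF // andbT.
  move: wd; rewrite defE => /and3P[/eqP-> /eqP w1 _].
  rewrite ltnn eqxx /fibre w1 inE /=; apply/esym/exists_inP.
  by have /set0Pn[x xw] := box_neq0 w; exists x; rewrite // inE.
rewrite in_setD !memE // defE; case: (ltngtP (weight w) h) => //= _.
rewrite /fibre; case: (nat_of_ord _) => [|[|n]] //=; rewrite ?inE //.
rewrite negb_forall_in; set b := [exists _ in _, _].
suff -> : [exists x in box w, (v.1 - x, v.2) \notin set0] by rewrite andbT.
by have /set0Pn[x xw] := box_neq0 w; apply/exists_inP; exists x; rewrite // inE.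
Qed.

End Fibres.

(** * Labellings with prescribed multiplicities *)

Lemma exists_labelling (S I : finType) (r : I -> nat) :
  (\sum_i r i <= #|S|)%N ->
  exists lab : S -> option I, forall P : pred (option I), ~~ P None ->
    #|[set s | P (lab s)]| = (\sum_i P (Some i) * r i)%N.
Proof.
(* List [r i] copies of each [Some i], pad with [None] to length [#|S|], and read the labels along
   [enum S]. *)
move=> rS; pose l := flatten [seq nseq (r i) (Some i) | i <- enum I].
have sl : size l = (\sum_i r i)%N.
  rewrite size_flatten /shape -map_comp sumnE big_map big_enum.
  by apply: eq_bigr => i _ /=; rewrite size_nseq.
pose l' := l ++ nseq (#|S| - size l) None.
have sl' : size l' = #|S| by rewrite size_cat size_nseq sl subnKC.
pose lab s := nth None l' (index s (enum S)); exists lab => P /negPf PN.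
have labE : [seq lab s | s <- enum S] = l'.
  apply: (@eq_from_nth _ None); rewrite size_map -cardE ?sl' // => k kS.
  pose s0 := enum_val (Ordinal kS).
  by rewrite (nth_map s0) -?cardE // /lab index_uniq ?enum_uniq // -cardE.
rewrite cardsE cardE /enum_mem size_filter -enumT.
transitivity (count P l'); first by rewrite -labE !count_map; apply: eq_count.
rewrite count_cat count_nseq PN addn0 count_flatten -map_comp sumnE big_map big_enum.
by apply: eq_bigr => i _; rewrite /= count_nseq.
Qed.

(** * Counting box translates inside orthants *)

Section Cone.
Variables (p : nat) (p_prime : prime p) (H : nat) (Q S : finZmodType).
Hypothesis Q_gt2 : (2 < #|Q|)%N.
Local Notation W := {ffun option 'I_H -> 'F_p}.
Local Notation U := {ffun 'I_H -> Q}.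

Definition orthant (j : 'I_H) : {set U} :=
  [set q : U | [forall k, (q k != 0) == (k < j)%N]].

Definition orthants (lab : S -> option 'I_H) : {set U * S} :=
  [set v | oapp (fun j => v.1 \in orthant j) false (lab v.2)].

Lemma in_orthants lab u s :
  ((u, s) \in orthants lab) = oapp (fun j => u \in orthant j) false (lab s).
Proof. by rewrite inE. Qed.

(* The translates [u - box w] of boxes of weight [h - 1] that fit in [orthant j]. *)
Definition translates (h : nat) (j : 'I_H) : {set W * U} :=
  [set z : W * U | [&& weight z.1 == h, z.1 None == 1%N :> nat
    & [forall y in box Q z.1, z.2 - y \in orthant j]]].

(** Boxes live in [U] alone, so the count splits over [s]; an unlabelled [s] contributes nothing
    because boxes are nonempty. *)
Lemma card_deficit (lab : S -> option 'I_H) h :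
  #|@deficit p H Q S (orthants lab) h| =
  (\sum_j #|[set s | lab s == Some j]| * #|translates h j|)%N.
Proof.
rewrite -sum1_card (partition_big (fun x => x.2.2) predT) //=.
transitivity (\sum_s \sum_j (lab s == Some j) * #|translates h j|)%N; last first.
  rewrite exchange_big /=; apply: eq_bigr => j _.
  rewrite -big_distrl /=; congr (_ * _)%N.
  by rewrite -sum1_card [RHS]big_mkcond; apply: eq_bigr => s _; rewrite inE; case: eqP.
apply: eq_bigr => s _; rewrite sum1_card.
case labs: (lab s) => [j|]; last first.
  rewrite big1; last by [].
  apply: eq_card0 => -[w [u s']]; rewrite -topredE /= !inE /=; apply/negP.
  case/andP=> /and3P[_ _ /forall_inP wb] /eqP s'E.
  have /set0Pn[x /wb] := box_neq0 Q_gt2 w.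
  by rewrite in_orthants s'E labs.
rewrite (bigD1 j) //= eqxx mul1n big1 ?addn0; last first.
  by move=> k /negPf kj; rewrite (inj_eq (@Some_inj _)) eq_sym kj.
have inj : injective (fun z : W * U => (z.1, (z.2, s))).
  by move=> [? ?] [? ?] [-> ->].
rewrite -(card_imset _ inj); apply: eq_card => -[w [u s']].
rewrite -topredE /= andbC; apply/andP/imsetP.
  case=> /eqP->; rewrite inE => /and3P[/= wh w1 /forall_inP wb].
  exists (w, u); rewrite // inE wh w1 /=; apply/forall_inP => y /wb.
  by rewrite in_orthants labs.
case=> -[w' u']; rewrite inE => /and3P[/= wh w1 /forall_inP wb] [-> -> ->].
split=> //; rewrite inE wh w1 /=; apply/forall_inP => y /wb.
by rewrite in_orthants labs.
Qed.

(** A box is a product: one coordinate of a box point can vary alone, so containment is tested axis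
    by axis. *)
Lemma translates_digit h j z : z \in translates h j ->
  forall k a, digit (z.1 (Some k)) a -> (z.2 k - a != 0) = (k < j)%N.
Proof.
rewrite inE => /and3P[_ _ /forall_inP zb] k a ka.
have /set0Pn[y0 y0z] := box_neq0 Q_gt2 z.1.
have /zb : [ffun i => if i == k then a else y0 i] \in box Q z.1.
  move: y0z; rewrite !inE => /forallP y0z; apply/forallP=> i; rewrite ffunE.
  by case: eqP => [->|].
by rewrite inE => /forallP/(_ k)/eqP; rewrite !ffunE eqxx.
Qed.

(** A full axis fits in no factor of the orthant; a punctured axis fits only in [Q \ {0}], and only
    untranslated. *)
Lemma translates_le h j z : z \in translates h j ->
  forall k, (z.1 (Some k) <= (k < j))%N /\
    ((z.1 (Some k) = (k < j)%N :> nat) -> z.2 k = 0).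
Proof.
move=> /translates_digit zd k; have := zd k; case: (nat_of_ord _) => [|[|n]] /= zk.
- have := zk 0 (eqxx _); rewrite subr0.
  by case: (k < j)%N => // /negbFE/eqP.
- have [a a0 au] := exists_neq2 Q_gt2 0 (z.2 k).
  have := zk a a0; rewrite subr_eq0 eq_sym au => <-; split=> // _.
  apply/eqP; apply: contraT => /zk; rewrite subrr eqxx => /esym.
  by have := zk a a0; rewrite subr_eq0 eq_sym au => <-.
have := zk (z.2 k) isT; rewrite subrr eqxx => <-.
have [a a0 _] := exists_neq2 Q_gt2 (z.2 k) 0.
have := zk a isT; have := zk (z.2 k) isT; rewrite subrr eqxx => <-.
by rewrite subr_eq0 eq_sym a0.
Qed.

Lemma big_option (I : finType) (f : option I -> nat) :
  (\sum_g f g = f None + \sum_i f (Some i))%N.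
Proof.
rewrite (bigD1 None) //=; congr (_ + _)%N.
rewrite (reindex_omap Some id) //=; last by case.
by apply: eq_bigl => i; rewrite eqxx.
Qed.

Lemma sum_ltn (j : 'I_H) : (\sum_(k < H) (k < j)%N = j)%N.
Proof.
have {2}-> : nat_of_ord j = (\sum_(i < j) 1)%N by rewrite sum_nat_const card_ord muln1.
by rewrite (big_ord_widen _ (fun=> 1%N) (ltnW (ltn_ord j))) [RHS]big_mkcond.
Qed.

Lemma translates0 (i j : 'I_H) : (j < i)%N -> #|translates i.+1 j| = 0%N.
Proof.
move=> ji; apply: eq_card0 => z; apply/negP => zt.
move: (zt); rewrite inE /weight big_option => /and3P[/eqP iE /eqP w1 _].
move: iE ji; rewrite w1 => -[iE]; rewrite -iE -{1}(sum_ltn j) ltnNge leq_sum // => k _.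
by case: (translates_le zt k).
Qed.

Lemma translates1 (j : 'I_H) : #|translates j.+1 j| = 1%N.
Proof.
have val1 : (1 : 'F_p) = 1%N :> nat.
  by rewrite -[1 in LHS]add0r val_FpS //=; case: eqP p_prime => // <-.
(* The unique solution has residue 1 on [y] and on the axes below [j], and translation 0. *)
pose w0 : W := [ffun g => oapp (fun k : 'I_H => (k < j)%N%:R) 1 g].
have w0E k : w0 (Some k) = (k < j)%N :> nat.
  by rewrite ffunE /=; case: (k < j)%N; rewrite /= ?val1.
apply/eqP/cards1P; exists (w0, 0); apply/setP=> -[w u]; rewrite [RHS]inE.
apply/idP/eqP => [zt|[-> ->]]; last first.
  rewrite inE /= /weight big_option [in X in (X + _)%N]ffunE val1 ffunE val1 eqxx.
  rewrite (eq_bigr _ (fun k _ => w0E k)) sum_ltn eqxx /=.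
  apply/forall_inP => y; rewrite !inE => /forallP yb; apply/forallP=> k.
  have := yb k; rewrite w0E !ffunE sub0r oppr_eq0.
  by case: ltnP => //= _ => [->|/eqP->]; rewrite ?eqxx.
have zle := translates_le zt.
move: (zt); rewrite inE /weight big_option => /and3P[/= /eqP + /eqP w1 _].
rewrite w1 => -[]; rewrite -[X in _ = X]sum_ltn => /eqP.
have [_ ->] := @leqif_sum _ xpredT (fun k => (w (Some k) == (k < j)%N :> nat))
  (fun k => (w (Some k) : nat)) (fun k => (k < j)%N : nat)
  (fun k _ => leqif_eq (proj1 (zle k))).
move/forall_inP => wE; congr pair; apply/ffunP.
  case=> [k|]; apply: val_inj; first by rewrite /= w0E; apply/eqP/wE.
  by rewrite ffunE; apply: etrans w1 (esym val1).
by move=> k; rewrite ffunE; apply: (proj2 (zle k)); apply/eqP/wE.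
Qed.

End Cone.

(** * Sparsity by size, and the final construction *)

Lemma exists_sum_notin (S : finZmodType) (B : {set S}) (t : S) :
  (2 * #|B| < #|S|)%N -> exists a b, [/\ a \notin B, b \notin B & t = a + b].
Proof.
move=> BS; have inj : injective (fun b => t - b) by move=> x y /addrI/oppr_inj.
(* [B] and [t - B] are together too small to cover [S]. *)
have /subsetPn[a _] : ~~ ([set: S] \subset B :|: [set t - b | b in B]).
  apply: contraL BS => /subset_leq_card; rewrite cardsT -leqNgt => /leq_trans; apply.
  by rewrite (leq_trans (leq_card_setU _ _)) // card_imset // mul2n addnn.
rewrite inE negb_or => /andP[aB atB]; exists a, (t - a); split=> //.
  by apply: contra atB => tB; apply/imsetP; exists (t - a); rewrite ?subKr.
by rewrite addrC subrK.
Qed.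

(** The orthants lie over labelled [s], fewer than half of [S], so the splitting is done in [S] and
    [u] goes into one summand. *)
Lemma sparse_orthants (H : nat) (Q S : finZmodType) (lab : S -> option 'I_H) :
  (2 * #|[set s | lab s]| < #|S|)%N -> sparse (@orthants H Q S lab).
Proof.
move=> labS [u s]; have [a [b []]] := exists_sum_notin s labS.
rewrite !inE => aN bN ->; exists (0, a), (u, b); rewrite !in_orthants.
case: (lab a) (lab b) aN bN => [//|] [//|] _ _; split=> //.
by congr pair; rewrite add0r.
Qed.

(* m i stands for m_(i+1), so that i : 'I_H encodes 1 <= h <= H via h = i.+1 *)
Theorem theorem1p3 (p : nat) (p_prime : prime p)
    (H : nat) (H_gt0 : (0 < H)%N) (m : 'I_H -> int) :
  exists N0 : nat, forall N : nat, (N0 <= N)%N ->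
    exists A B : {set 'rV['F_p]_N},
      forall i : 'I_H,
        #|sumset i.+1 A|%:Z - #|sumset i.+1 B|%:Z = m i.
Proof.
(* ['F_p] itself is too small when [p = 2]; its square has at least 4 elements. *)
pose Q : finZmodType := ('F_p * 'F_p)%type.
have Q_gt2 : (2 < #|Q|)%N.
  rewrite card_prod card_Fp //; apply: (@leq_trans (2 * 2)) => //.
  by rewrite leq_mul ?prime_gt1.
pose T : 'M[int]_H := \matrix_(j, i) #|translates p Q i.+1 j|%:Z.
have T_unit : T \in unitmx.
  rewrite unitmxE det_trig ?big1 ?unitr1 // => [j _|].
    by rewrite mxE translates1.
  by apply/is_trig_mxP => j i ji; rewrite mxE translates0.
pose d := (\row_i m i) *m invmx T.
have dT (i : 'I_H) : \sum_j d ord0 j * #|translates p Q i.+1 j|%:Z = m i.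
  have := mulmxKV T_unit (\row_i m i); rewrite -/d => /matrixP/(_ ord0 i).
  rewrite mxE [RHS]mxE => <-; apply: eq_bigr => j _; congr (_ * _).
  by rewrite mxE.
pose pos j := if d ord0 j is Posz n then n else 0%N.
pose neg j := if d ord0 j is Negz n then n.+1 else 0%N.
have posneg j : d ord0 j = (pos j)%:Z - (neg j)%:Z.
  by rewrite /pos /neg; case: (d _ _) => n; rewrite ?subr0 ?sub0r ?NegzE.
(* Then [#|S| = p ^ s] exceeds twice the number of labels used for either set, as sparsity
   requires. *)
pose s := (2 * (\sum_j pos j + \sum_j neg j))%N.
pose S : finZmodType := {ffun 'I_s -> 'F_p}.
have sS : (s < #|S|)%N by rewrite card_ffun card_Fp // card_ord ltn_expl ?prime_gt1.
have realize (r : 'I_H -> nat) : (2 * \sum_j r j <= s)%N ->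
    exists lab : S -> option 'I_H,
    sparse (@orthants H Q S lab) /\ forall h,
    (#|sumset h (graded_set p (generators (@orthants H Q S lab)))|
     + \sum_j r j * #|translates p Q h j|
     = #|sumset h (graded_set p (@generators H Q S set0))|)%N.
  move=> rs; have rS : (\sum_j r j <= #|S|)%N.
    by apply: leq_trans (ltnW sS); apply: leq_trans rs; rewrite leq_pmull.
  have [lab labE] := exists_labelling rS; exists lab.
  have labsp : sparse (@orthants H Q S lab).
    apply: sparse_orthants; rewrite (labE isSome) //.
    by under eq_bigr do rewrite mul1n; apply: leq_ltn_trans rs sS.
  split=> // h; rewrite -(card_sumset_deficit p_prime Q_gt2 h labsp) card_deficit //.
  congr (_ + _)%N; apply: eq_bigr => j _; congr (_ * _)%N.
  rewrite (labE (pred1 (Some j))) // (bigD1 j) //= eqxx mul1n big1 ?addn0 //.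
  move=> k /negPf kj.
  by rewrite (inj_eq (@Some_inj _)) kj.
(* Deficits are subtracted, so [A] takes the negative parts and [B] the positive ones. *)
have [|labA [_ cardA]] := realize neg.
  by rewrite leq_mul // leq_addl.
have [|labB [_ cardB]] := realize pos.
  by rewrite leq_mul // leq_addr.
(* The regular module makes the same group a vector space over ['F_p], whose dimension serves as
   [N0]. *)
pose F := (('F_p)^o)%R.
pose G : vectType 'F_p :=
  ({ffun option 'I_H -> F} * ({ffun 'I_H -> F * F} * {ffun 'I_s -> F}))%type.
exists (dim G) => N /vectType_embedding[f f_inj].
pose f' : {additive
  ({ffun option 'I_H -> 'F_p} * ({ffun 'I_H -> Q} * S))%type -> 'rV['F_p]_N} := f.
have f'_inj : injective f' := f_inj.
exists (f' @: graded_set p (generators (@orthants H Q S labA))),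
  (f' @: graded_set p (generators (@orthants H Q S labB))) => i.
rewrite !sumset_imset !(card_imset _ f'_inj) -dT.
have /(congr1 Posz) := etrans (cardA i.+1) (esym (cardB i.+1)).
rewrite !PoszD => AB; apply/eqP; rewrite subr_eq addrC.
rewrite -(inj_eq (addIr (\sum_j neg j * #|translates p Q i.+1 j|)%N%:Z)).
rewrite AB -addrA (inj_eq (addrI _)).
rewrite !(big_morph _ PoszD (erefl _)) -big_split /=; apply/eqP/eq_bigr => j _.
by rewrite posneg mulrBl !PoszM subrK.
Qed.
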